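(* Let $d\ge1$, $N\ge0$ be integers and $\kappa\in\mathbb R^{d+1}$ with all $\kappa_i>-1$. For $\alpha\in\mathbb N_0^{d+1}$ with $|\alpha|\le N$ and $x\in\mathbb Z_N^{d+1}$, $$\mathsf Q_\alpha(x;\kappa,N)=\frac{(-N)_{|\alpha|}(\kappa+\mathbf 1)_\alpha}{(|\kappa|+d+|\alpha|)_{|\alpha|}}\sum_{\gamma\le\alpha}\frac{(-\alpha)_\gamma(|\kappa|+d+|\alpha|)_{|\gamma|}(-1)^{|\gamma|}}{\gamma!\,(\kappa+\mathbf 1)_\gamma(-N)_{|\gamma|}}\,\mathrm m_\gamma(x),$$ where the sum is over $\gamma\in\mathbb N_0^{d+1}$ with $\gamma\le\alpha$ componentwise.
   Context: Notation: $(a)_n=a(a+1)\cdots(a+n-1)$, $(a)_0=1$; for vectors, $|y|$ is the sum of the components, $\alpha!=\prod_i\alpha_i!$, $(y)_\alpha=\prod_i(y_i)_{\alpha_i}$; $\mathbf 1=(1,\dots,1)$. $\mathbb Z_N^{d+1}=\{\alpha\in\mathbb N_0^{d+1}:|\alpha|=N\}$. Inner product: $\langle f,g\rangle_{\mathsf H_{\kappa,N}}=\frac{N!}{(|\kappa|+d+1)_N}\sum_{x\in\mathbb Z_N^{d+1}}f(x)g(x)\frac{(\kappa+\mathbf 1)_x}{x!}$. $\Pi_n^d$ is the space of polynomials of total degree at most $n$ in $x_1,\dots,x_d$ ($\Pi_{-1}^d=\{0\}$), regarded as functions on $\mathbb Z_N^{d+1}$ (where $x_{d+1}=N-x_1-\cdots-x_d$);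 polynomials in $x_1,\dots,x_{d+1}$ are regarded as functions on $\mathbb Z_N^{d+1}$ in the same way. For $0\le n\le N$, $\mathcal V_n^d(\mathsf H_{\kappa,N})$ is the space of $p\in\Pi_n^d$ orthogonal to $\Pi_{n-1}^d$. Let $\mathrm m_\alpha(x)=(-1)^{|\alpha|}(-x)_\alpha$. For $|\alpha|\le N$ the monic Hahn polynomial $\mathsf Q_\alpha(\cdot;\kappa,N)$ is the unique element of $\mathcal V_{|\alpha|}^d(\mathsf H_{\kappa,N})$ with $\mathsf Q_\alpha-\mathrm m_\alpha\in\Pi_{|\alpha|-1}^d$ (as functions on $\mathbb Z_N^{d+1}$). *)

(* Defs.v *)
From HB Require Import structures.
From mathcomp Require Import all_boot all_order all_algebra.
From mathcomp Require Import boolp classical_sets reals.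
From mathcomp Require Import mpoly.

Set Implicit Arguments.
Unset Strict Implicit.
Unset Printing Implicit Defensive.

Import Order.TTheory GRing.Theory Num.Theory.
Local Open Scope ring_scope.

Definition poch (R : realType) (a : R) (n : nat) : R :=
  \prod_(i < n) (a + i%:R).

Definition mpoch (R : realType) (k : nat) (y : 'I_k -> R) (alpha : 'X_{1..k}) : R :=
  \prod_(i < k) poch (y i) (alpha i).

Definition mfact (k : nat) (alpha : 'X_{1..k}) : nat :=
  (\prod_(i < k) (alpha i)`!)%N.

(* Z_N^{d+1}; the bound in the carrier is implied by |x| = N and only serves
   to make the type finite. *)
Definition lattice (d N : nat) : finType :=
  {x : 'X_{1..d.+1 < N.+1} | mdeg x == N}.

Definition pt (d N : nat) (x : lattice d N) : 'X_{1..d.+1} := bmnm (val x).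

Definition hahn_inner (R : realType) (d N : nat) (kappa : 'I_d.+1 -> R)
    (f g : {ffun lattice d N -> R}) : R :=
  N`!%:R / poch (\sum_i kappa i + d%:R + 1) N *
  \sum_(x : lattice d N)
     f x * g x * (mpoch (fun i => kappa i + 1) (pt x) / (mfact (pt x))%:R).

(* The function on Z_N^{d+1} induced by a polynomial in x_1, ..., x_d. *)
Definition polyfun (R : realType) (d N : nat) (p : {mpoly R[d]}) :
    {ffun lattice d N -> R} :=
  [ffun x => p.@[fun i : 'I_d => (pt x (widen_ord (leqnSn d) i))%:R]].

(* Polynomials of total degree < n: Pi_n^d is [deg_lt n.+1], Pi_{n-1}^d is
   [deg_lt n], and [deg_lt 0] is {0} since [msize] is the degree plus one. *)
Definition deg_lt (R : realType) (d N n : nat) : set {ffun lattice d N -> R} :=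
  [set f | exists2 p : {mpoly R[d]}, (msize p <= n)%N & f = polyfun N p]%classic.
Arguments deg_lt : clear implicits.

Definition hahn_space (R : realType) (d N : nat) (kappa : 'I_d.+1 -> R)
    (n : nat) : set {ffun lattice d N -> R} :=
  [set f | deg_lt R d N n.+1 f /\
     forall g, deg_lt R d N n g -> hahn_inner kappa f g = 0]%classic.

Definition hahn_m (R : realType) (d N : nat) (alpha : 'X_{1..d.+1}) :
    {ffun lattice d N -> R} :=
  [ffun x => (-1) ^+ mdeg alpha * mpoch (fun i => - (pt x i)%:R) alpha].
Arguments hahn_m : clear implicits.

Definition is_monic_hahn (R : realType) (d N : nat) (kappa : 'I_d.+1 -> R)
    (alpha : 'X_{1..d.+1}) (Q : {ffun lattice d N -> R}) : Prop :=
  hahn_space kappa (mdeg alpha) Q /\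
  deg_lt R d N (mdeg alpha) (Q - hahn_m R d N alpha).

(* Q_alpha(.; kappa, N), by definite description; the default value 0 of
   [xget] is irrelevant, as such an element exists and is unique when
   kappa > -1 and |alpha| <= N. *)
Definition monic_hahn (R : realType) (d N : nat) (kappa : 'I_d.+1 -> R)
    (alpha : 'X_{1..d.+1}) : {ffun lattice d N -> R} :=
  xget 0 [set Q | is_monic_hahn kappa alpha Q]%classic.
Arguments monic_hahn {R d} N kappa alpha.

(* Main.v *)
(* With [a = kappa + 1], the Hahn weight absorbs test functions of the form
   [(a + x)_beta], since [(a)_x (a + x)_beta = (a)_(x + beta)], and
   [m_gamma(x) / x! = 1 / (x - gamma)!].  Hence the inner product of [m_gamma]
   with [(a + x)_beta] is a Chu-Vandermonde sum.  Inserted in the expansion of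
   [Q_alpha], it leaves
     [\sum_(gamma <= alpha) (-1)^|gamma| binomial(alpha, gamma) P(gamma)]
   with [P] a polynomial of degree [|alpha| - 1] as soon as
   [|beta| < |alpha|]; such a mixed finite difference vanishes.  The functions
   [(a + x)_beta] with [|beta| < n] span [Pi_(n-1)], and the inner product is
   positive definite, which gives uniqueness. *)
Require Import Defs.
From mathcomp Require Import all_boot all_order all_algebra.
From mathcomp Require Import boolp classical_sets reals.
From mathcomp Require Import ring.
From mathcomp Require Import mpoly.
Import Order.TTheory GRing.Theory Num.Theory.
Local Open Scope ring_scope.

(** * Pochhammer symbols and multi-index factorials *)

Lemma poch0 {R : realType} (a : R) : poch a 0 = 1.
Proof. by rewrite /poch big_ord0. Qed.

Lemma pochS {R : realType} (a : R) n : poch a n.+1 = poch a n * (a + n%:R).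
Proof. by rewrite /poch big_ord_recr. Qed.

Lemma pochD {R : realType} (a : R) m n :
  poch a (m + n) = poch a m * poch (a + m%:R) n.
Proof.
elim: n => [|n IHn]; first by rewrite addn0 poch0 mulr1.
by rewrite addnS !pochS IHn natrD mulrA addrA.
Qed.

Lemma poch_gt0 {R : realType} (a : R) n : 0 < a -> 0 < poch a n.
Proof. by move=> a_gt0; apply: prodr_gt0 => i _; rewrite ltr_wpDr. Qed.

Lemma poch_opp {R : realType} (n m : nat) :
  poch (- n%:R : R) m = (-1) ^+ m * (n ^_ m)%:R.
Proof.
elim: m => [|m IHm]; first by rewrite poch0 ffactn0 expr0 mul1r.
rewrite pochS IHm ffactnSr exprSr -!mulrA; congr (_ * _).
(* Beyond [n] the natural subtraction in [ffactnSr] truncates, but there the falling factorial is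
   already zero. *)
case: (leqP m n) => [le_mn | lt_nm].
  by rewrite natrM natrB // mulrCA mulN1r opprB addrC.
by rewrite ffact_small // mul0n mul0r mulr0.
Qed.

Lemma mpochD {R : realType} {k} (y : 'I_k -> R) (a b : 'X_{1..k}) :
  mpoch y (a + b)%MM = mpoch y a * mpoch (fun i => y i + (a i)%:R) b.
Proof.
by rewrite -big_split; apply: eq_bigr => i _; rewrite mnmDE pochD.
Qed.

Lemma mpoch1 {R : realType} {k} (y : 'I_k -> R) i : mpoch y U_(i)%MM = y i.
Proof.
rewrite /mpoch (bigD1 i) //= mnm1E eqxx big1 => [|j ne_ji].
  by rewrite mulr1 pochS poch0 mul1r addr0.
by rewrite mnm1E eq_sym (negbTE ne_ji) poch0.
Qed.

Lemma mpoch_gt0 {R : realType} {k} (y : 'I_k -> R) (a : 'X_{1..k}) :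
  (forall i, 0 < y i) -> 0 < mpoch y a.
Proof. by move=> y_gt0; apply: prodr_gt0 => i _; apply: poch_gt0. Qed.

Lemma mfact_gt0 {k} (a : 'X_{1..k}) : (0 < mfact a)%N.
Proof. by apply: prodn_gt0 => i; apply: fact_gt0. Qed.

Lemma prodr_exp_mdeg {R : comPzRingType} {k} (c : R) (a : 'X_{1..k}) :
  \prod_i c ^+ a i = c ^+ mdeg a.
Proof. by rewrite prodrXr mdegE. Qed.

Lemma mpoch_opp {R : realType} {k} (x a : 'X_{1..k}) :
  mpoch (fun i => - (x i)%:R : R) a =
  (-1) ^+ mdeg a * \prod_i (x i ^_ a i)%:R.
Proof.
rewrite -prodr_exp_mdeg -big_split.
by apply: eq_bigr => i _; rewrite poch_opp.
Qed.

(** * Finite differences *)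

(** Induction on [m], splitting off one factor [c + j]. The part with [c] has a lower exponent; the
    part with [j] is absorbed by [j 'C(a, j) = a 'C(a.-1, j.-1)], which lowers the order and shifts
    [c] to [c + 1], hence the general [c]. *)
Lemma alternating_sum_bin_exp {R : comNzRingType} (a m : nat) (c : R) :
  (m < a)%N ->
  \sum_(j < a.+1) (-1) ^+ j * 'C(a, j)%:R * (c + j%:R) ^+ m = 0.
Proof.
elim: m a c => [|m IHm] [|a] c // lt_ma.
  transitivity ((1 - 1 : R) ^+ a.+1); last by rewrite subrr expr0n.
  rewrite exprBn; apply: eq_bigr => j _.
  by rewrite !expr1n !mulr1 mulr_natr.
under eq_bigr => j _ do rewrite exprS mulrDl mulrDr mulrCA.
rewrite big_split /= -mulr_sumr IHm ?(ltnW lt_ma) // mulr0 add0r.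
rewrite big_ord_recl mul0r mulr0 add0r.
transitivity (- a.+1%:R *
  \sum_(j < a.+1) (-1) ^+ j * 'C(a, j)%:R * ((c + 1) + j%:R) ^+ m).
  rewrite mulr_sumr; apply: eq_bigr => j _.
  have binE : 'C(a.+1, j.+1)%:R * j.+1%:R = a.+1%:R * 'C(a, j)%:R :> R.
    by rewrite -!natrM mulnC -mul_bin_diag.
  rewrite lift0 -[c + 1 + _]addrA nat1r [LHS]mulrA.
  rewrite -[_ * _ * j.+1%:R]mulrA binE.
  by rewrite exprS mulN1r !mulNr !mulrA [_ * a.+1%:R]mulrC.
by rewrite IHm ?mulr0.
Qed.

(** Distributivity: choosing one index in each coordinate amounts to choosing a multi-index below
    [alpha]. *)
Lemma sum_lepm_prod {R : comPzRingType} {k} (alpha : 'X_{1..k})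
    (F : 'I_k -> nat -> R) :
  \sum_(gamma : 'X_{1..k < (mdeg alpha).+1} | (gamma <= alpha)%MM)
     \prod_i F i (gamma i) =
  \prod_i \sum_(j < (alpha i).+1) F i j.
Proof.
set n := mdeg alpha.
have le_n i : (alpha i <= n)%N by rewrite /n mdegE (bigD1 i) //= leq_addr.
have le_mdeg (g : 'X_{1..k}) : (g <= alpha)%MM -> (mdeg g < n.+1)%N.
  by move=> /mnm_lepP le_g; rewrite ltnS /n !mdegE leq_sum.
(* The coordinate ranges are widened to the common type ['I_n.+1], so that choices of indices are
   functions into a single type. *)
under [RHS]eq_bigr => i _.
  rewrite (big_ord_widen _ (F i) (_ : ((alpha i).+1 <= n.+1)%N)); last first.
    by rewrite ltnS.
  over.
rewrite bigA_distr_big_dep /=.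
pose h (g : 'X_{1..k < n.+1}) : {ffun 'I_k -> 'I_n.+1} :=
  [ffun i => inord (g i)].
pose h' (f : {ffun 'I_k -> 'I_n.+1}) : 'X_{1..k < n.+1} :=
  insubd bm0 [multinom (f i : nat) | i < k].
have hE (g : 'X_{1..k < n.+1}) i : (g <= alpha)%MM -> h g i = g i :> nat.
  by move=> /mnm_lepP le_g; rewrite ffunE inordK // ltnS (leq_trans (le_g i)).
rewrite (reindex_onto h h') => [|f /familyP f_le].
  apply: eq_big => [g|g le_g]; last first.
    by apply: eq_bigr => i _; rewrite hE.
  apply/idP/idP => [le_g|].
    apply/andP; split.
      by apply/familyP => i; rewrite unfold_in /= hE //; apply: (mnm_lepP le_g).
    apply/eqP/val_inj; rewrite /h' val_insubd.
    have -> : [multinom (h g i : nat) | i < k] = g.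
      by apply/mnmP => i; rewrite mnmE hE.
    by rewrite le_mdeg.
  case/andP=> /familyP g_le /eqP <-; apply/mnm_lepP => i.
  (* The default value of [h'] is the zero multi-index, which also lies below [alpha]. *)
  rewrite /h' val_insubd; case: ifP => _; last by rewrite mnm0E.
  by rewrite mnmE; apply: g_le.
have h'E : h' f = [multinom (f i : nat) | i < k] :> 'X_{1..k}.
  rewrite /h' val_insubd le_mdeg //.
  by apply/mnm_lepP => j; rewrite mnmE; apply: f_le.
by apply/ffunP => i; apply/val_inj; rewrite ffunE h'E mnmE inord_val.
Qed.

(* A mixed finite difference of order [alpha] kills every polynomial of degree
   less than [|alpha|]: on a monomial the sum factors over the coordinates, and
   in some coordinate the exponent is below the order of the difference. *)
Lemma alternating_sum_mpoly {R : comNzRingType} {k} (alpha : 'X_{1..k})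
    (p : {mpoly R[k]}) :
  (msize p <= mdeg alpha)%N ->
  \sum_(gamma : 'X_{1..k < (mdeg alpha).+1} | (gamma <= alpha)%MM)
     (\prod_i ((-1) ^+ gamma i * 'C(alpha i, gamma i)%:R)) *
     p.@[fun i => (gamma i)%:R] = 0.
Proof.
move=> le_p.
under eq_bigr => g _ do rewrite mevalE mulr_sumr.
rewrite exchange_big big_seq big1 //= => m m_p.
under eq_bigr => g _ do rewrite mulrCA -big_split.
rewrite -mulr_sumr (sum_lepm_prod alpha (fun i j =>
  (-1) ^+ j * 'C(alpha i, j)%:R * j%:R ^+ m i)).
have [i lt_i] : exists i, (m i < alpha i)%N.
  apply/existsP; apply: contraT; rewrite negb_exists => /forallP ge_m.
  have := leq_trans (msize_mdeg_lt m_p) le_p; rewrite ltnNge !mdegE leq_sum //.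
  by move=> i _; rewrite leqNgt ge_m.
rewrite (bigD1 i) //= (_ : \sum_(j < _) _ = 0) ?mul0r ?mulr0 //.
rewrite -[RHS](alternating_sum_bin_exp _ _ 0 lt_i).
by apply: eq_bigr => j _; rewrite add0r.
Qed.

(** * Degree bounds for products *)

(** Since [msize] is the degree plus one, bounds with a successor are degree bounds, which add under
    products; the zero polynomial satisfies all of them. *)
Lemma msizeM_leS {R : idomainType} {k} (p q : {mpoly R[k]}) a b :
  (msize p <= a.+1)%N -> (msize q <= b.+1)%N -> (msize (p * q) <= (a + b).+1)%N.
Proof.
have [->|p_neq0] := eqVneq p 0; first by rewrite mul0r msize0.
have [->|q_neq0] := eqVneq q 0; first by rewrite mulr0 msize0.
move=> le_p le_q; rewrite msizeM // -ltnS.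
case: (msize p + msize q)%N (leq_add le_p le_q) => //= n.
by rewrite addSn addnS.
Qed.

Lemma msize_prod_leS {R : idomainType} {k} (I : Type) (r : seq I)
    (F : I -> {mpoly R[k]}) (a : I -> nat) :
  (forall i, (msize (F i) <= (a i).+1)%N) ->
  (msize (\prod_(i <- r) F i) <= (\sum_(i <- r) a i).+1)%N.
Proof.
move=> le_F; elim: r => [|i r IHr]; first by rewrite !big_nil msize1.
by rewrite !big_cons msizeM_leS.
Qed.

Lemma msize_prod_affine {R : idomainType} {k} n (F : nat -> {mpoly R[k]}) :
  (forall i, (msize (F i) <= 2)%N) -> (msize (\prod_(i < n) F i) <= n.+1)%N.
Proof.
move=> le_F; rewrite -[n in n.+1]subn0 -[(n - 0)%N]muln1 -sum_nat_const_nat.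
by rewrite big_mkord; apply: msize_prod_leS.
Qed.

Lemma msize_affine {R : nzRingType} {k} (c : R) (p : {mpoly R[k]}) :
  (msize p <= 2)%N -> (msize (c%:MP + p) <= 2)%N.
Proof.
move=> le_p; apply: leq_trans (msizeD_le _ _) _.
by rewrite geq_max le_p msizeC (leq_trans (leq_b1 _)).
Qed.

Lemma msize_sumX {R : nzRingType} {k} :
  (msize (\sum_i 'X_i : {mpoly R[k]}) <= 2)%N.
Proof.
apply: leq_trans (msize_sum _ _ _) _.
by apply/bigmax_leqP => i _; rewrite msizeX mdeg1.
Qed.

(** * Sums over the lattice *)

Lemma hahn_mE {R : realType} {d N} (gamma : 'X_{1..d.+1}) (x : lattice d N) :
  hahn_m R d N gamma x = \prod_i (pt x i ^_ gamma i)%:R.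
Proof.
by rewrite ffunE mpoch_opp mulrA -exprMn mulrNN mulr1 expr1n mul1r.
Qed.

Lemma mem_lattice {d N} (m : 'X_{1..d.+1}) :
  (m \in codom (@pt d N)) = (mdeg m == N).
Proof.
apply/codomP/idP => [[x ->]|/eqP m_N]; first exact: (valP x).
have lt_m : (mdeg m < N.+1)%N by rewrite m_N.
have m'_N : mdeg (BMultinom lt_m) == N by rewrite /= m_N.
by exists (Sub (BMultinom lt_m) m'_N); rewrite /pt SubK.
Qed.

Lemma uniq_lattice d N : uniq (codom (@pt d N)).
Proof.
by rewrite map_inj_uniq ?enum_uniq // => x y eq_xy; apply/val_inj/val_inj.
Qed.

Lemma mdeg_pt {d N} (x : lattice d N) : mdeg (pt x) = N.
Proof. by apply/eqP; rewrite -(mem_lattice (pt x)) codom_f. Qed.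

(** Substitution [x = y + gamma]. The two lattices are different types, so both sums are compared as
    sums over duplicate-free lists of multi-indices with the same members. *)
Lemma sum_lattice_shift {R : nmodType} {d N M} (gamma : 'X_{1..d.+1})
    (F : 'X_{1..d.+1} -> R) :
  (M + mdeg gamma = N)%N ->
  \sum_(x : lattice d N | (gamma <= pt x)%MM) F (pt x) =
  \sum_(y : lattice d M) F (pt y + gamma)%MM.
Proof.
move=> <-.
have -> : \sum_(y : lattice d M) F (pt y + gamma)%MM =
    \sum_(m <- [seq (m + gamma)%MM | m <- codom (@pt d M)]) F m.
  by rewrite big_map big_image.
have -> : \sum_(x : lattice d (M + mdeg gamma) | (gamma <= pt x)%MM) F (pt x) =
    \sum_(m <- [seq m <- codom (@pt d (M + mdeg gamma)) |
                 (gamma <= m)%MM]) F m.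
  by rewrite big_filter big_image_cond.
apply: perm_big; apply: uniq_perm.
- by rewrite filter_uniq ?uniq_lattice.
- by rewrite map_inj_uniq ?uniq_lattice //; apply: addIm.
move=> m; rewrite mem_filter mem_lattice; apply/andP/mapP => [[le_gm /eqP m_N]|].
  exists (m - gamma)%MM; last by rewrite submK.
  rewrite mem_lattice; move: m_N; rewrite -{1}(submK le_gm) mdegD => /eqP.
  by rewrite eqn_add2r.
case=> m'; rewrite mem_lattice => /eqP m'_M ->.
by rewrite lem_addl mdegD m'_M.
Qed.

(** [m_gamma(x)] vanishes unless [gamma <= x], and equals [x! / y!] at [x = y + gamma]. *)
Lemma sum_lattice_falling {R : realType} {d N M} (gamma : 'X_{1..d.+1})
    (F : 'X_{1..d.+1} -> R) :
  (M + mdeg gamma = N)%N ->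
  \sum_(x : lattice d N) hahn_m R d N gamma x * (F (pt x) / (mfact (pt x))%:R) =
  \sum_(y : lattice d M) F (pt y + gamma)%MM / (mfact (pt y))%:R.
Proof.
move=> def_N; pose G (x : 'X_{1..d.+1}) : R :=
   (\prod_i (x i ^_ gamma i))%N%:R * (F x / (mfact x)%:R).
rewrite (bigID (fun x => (gamma <= pt x)%MM)) /= [X in _ + X]big1 ?addr0.
  rewrite (eq_bigr (fun x => G (pt x))) => [|x _].
    rewrite (sum_lattice_shift _ G def_N); apply: eq_bigr => y _.
    rewrite /G mulrCA; congr (_ * _).
    have -> : mfact (pt y + gamma)%MM =
        (\prod_i (pt y + gamma)%MM i ^_ gamma i * mfact (pt y))%N.
      rewrite /mfact -big_split; apply: eq_bigr => i _ /=.
      have := ffact_fact (leq_addl (pt y i) (gamma i)).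
      by rewrite addnK mnmDE => ->.
    rewrite natrM invfM mulrA divff ?mul1r // pnatr_eq0 -lt0n.
    by apply: prodn_gt0 => i; rewrite ffact_gt0 mnmDE leq_addl.
  by rewrite /G hahn_mE natr_prod.
move=> x /negP nle; rewrite hahn_mE.
have [i lt_i] : exists i, (pt x i < gamma i)%N.
  apply/existsP; apply: contraT; rewrite negb_exists => /forallP ge_x.
  by case: nle; apply/mnm_lepP => i; rewrite leqNgt ge_x.
by rewrite (bigD1 i) //= ffact_small // !mul0r.
Qed.

(* Chu-Vandermonde; multiplying by [M.+1], the sum of the coordinates, gives the
   recursion [M.+1 * S M.+1 = (\sum_i a i + M) * S M]. *)
Lemma sum_lattice_poch {R : realType} {d} (M : nat) (a : 'I_d.+1 -> R) :
  \sum_(y : lattice d M) mpoch a (pt y) / (mfact (pt y))%:R =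
  poch (\sum_i a i) M / M`!%:R.
Proof.
elim: M => [|M IHM].
  transitivity (\sum_(m <- codom (@pt d 0))
                   mpoch a m / (mfact m)%:R).
    by rewrite big_image.
  rewrite (perm_big [:: 0%MM]) /=; last first.
    apply: uniq_perm; rewrite ?uniq_lattice // => m.
    by rewrite mem_lattice mdeg_eq0 inE.
  rewrite big_seq1 poch0 /mpoch /mfact !big1 // => i _.
    by rewrite mnm0E fact0.
  by rewrite mnm0E poch0.
apply: (@mulfI _ M.+1%:R); first by rewrite pnatr_eq0.
transitivity ((\sum_i a i + M%:R) *
    \sum_(y : lattice d M) mpoch a (pt y) / (mfact (pt y))%:R); last first.
  rewrite IHM pochS factS natrM invfM [RHS]mulrCA mulVKf ?pnatr_eq0 //.
  by rewrite mulrA (mulrC (poch _ _)).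
(* A coordinate is [x_i = m_gamma(x)] with [gamma = U_(i)], so each summand over [i] can be moved to
   the lattice of level [M]. *)
transitivity (\sum_i \sum_(x : lattice d M.+1)
    hahn_m R d M.+1 U_(i)%MM x * (mpoch a (pt x) / (mfact (pt x))%:R)).
  rewrite exchange_big mulr_sumr; apply: eq_bigr => x _.
  rewrite -mulr_suml; congr (_ * _).
  rewrite -{1}(mdeg_pt x) mdegE natr_sum; apply: eq_bigr => i _.
  rewrite hahn_mE (bigD1 i) //= mnm1E eqxx ffactn1 big1 ?mulr1 // => j ne_ji.
  by rewrite mnm1E eq_sym (negbTE ne_ji) ffactn0.
under eq_bigr => i _.
  rewrite (@sum_lattice_falling R d M.+1 M _ (mpoch a)); last first.
    by rewrite mdeg1 addn1.
  over.
rewrite exchange_big mulr_sumr; apply: eq_bigr => y _.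
rewrite -mulr_suml mulrA; congr (_ / _).
rewrite -[X in X%:R](mdeg_pt y) mdegE natr_sum -big_split mulr_suml.
by apply: eq_bigr => i _; rewrite mpochD mpoch1 mulrC.
Qed.

(** * The explicit sum and its orthogonality *)

(** [kd] is a free parameter because it takes two forms: [|kappa| + d + |alpha|] in the formula, and
    [\sum_i a i + |alpha| - 1] with [a = kappa + 1] for orthogonality. *)
Definition hahn_coef {R : realType} {k} (N : nat) (a : 'I_k -> R) (kd : R)
    (alpha gamma : 'X_{1..k}) : R :=
  (mpoch (fun i => - (alpha i)%:R) gamma * poch kd (mdeg gamma)
     * (-1) ^+ mdeg gamma)
  / ((mfact gamma)%:R * mpoch a gamma * poch (- N%:R) (mdeg gamma)).

Definition hahn_sum {R : realType} {d} (N : nat) (a : 'I_d.+1 -> R) (kd : R)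
    (alpha : 'X_{1..d.+1}) (x : lattice d N) : R :=
  \sum_(gamma : 'X_{1..d.+1 < (mdeg alpha).+1} | (gamma <= alpha)%MM)
    hahn_coef N a kd alpha gamma * hahn_m R d N gamma x.

Lemma poch_oppN_fact {R : realType} (N g : nat) :
  (g <= N)%N ->
  poch (- N%:R : R) g * (N - g)`!%:R = (-1) ^+ g * N`!%:R.
Proof. by move=> le_gN; rewrite poch_opp -mulrA -natrM ffact_fact. Qed.

Lemma poch_oppN_neq0 {R : realType} (N g : nat) :
  (g <= N)%N -> poch (- N%:R : R) g != 0.
Proof.
move=> le_gN; rewrite poch_opp mulf_neq0 ?signr_eq0 //.
by rewrite pnatr_eq0 -lt0n ffact_gt0.
Qed.

(** Exhibits the signed binomials of a mixed finite difference, with a factor that cancels [gamma!]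
    in the coefficients. *)
Lemma mpoch_opp_fact {R : realType} {k} (alpha gamma : 'X_{1..k}) :
  mpoch (fun i => - (alpha i)%:R : R) gamma =
  \prod_i ((-1) ^+ gamma i * 'C(alpha i, gamma i)%:R) * (mfact gamma)%:R.
Proof.
rewrite mpoch_opp big_split prodr_exp_mdeg -mulrA; congr (_ * _).
rewrite natr_prod -big_split; apply: eq_bigr => i _ /=.
by rewrite -natrM bin_ffact.
Qed.

(* [(s + n)_g] times the Chu-Vandermonde sum is, up to a factor independent of [g],
   a polynomial of degree [n - b] in [g]. *)
Lemma poch_quotient {R : realType} (s : R) (n N b g : nat) :
  0 < s -> (b <= n)%N -> (g <= N)%N ->
  poch (s + n%:R) g * poch (s + (b + g)%:R) (N - g) =
  poch s (b + N) / poch s n * poch (s + (b + g)%:R) (n - b).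
Proof.
move=> s_gt0 le_bn le_gN.
have poch_neq0 m : poch s m != 0 by rewrite gt_eqF ?poch_gt0.
(* After multiplication by [(s)_n], the symbols [(s)_(n+g)] and [(s)_(b+N)] both start with the
   block [(s)_(b+g)]. *)
apply: (mulfI (poch_neq0 n)); rewrite mulrA -pochD.
rewrite [in RHS]mulrA [poch s n * (_ / _)]mulrCA divff // mulr1.
have -> : (n + g = b + g + (n - b))%N by rewrite addnAC subnKC.
have -> : (b + N = b + g + (N - g))%N by rewrite -addnA subnKC.
by rewrite pochD (pochD s (b + g) (N - g)) mulrAC.
Qed.

(** All denominators depending on [gamma] cancel: [gamma!] against [(-alpha)_gamma], [(a)_gamma]
    against [(a)_(gamma+beta)], and [(-N)_|gamma| (N-|gamma|)!] is [N!] up to sign. *)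
Lemma hahn_coef_falling {R : realType} {k} (N : nat) (a : 'I_k -> R) (kd : R)
    (alpha beta gamma : 'X_{1..k}) :
  (forall i, 0 < a i) -> (mdeg gamma <= N)%N ->
  hahn_coef N a kd alpha gamma *
    (mpoch a (gamma + beta)%MM / (N - mdeg gamma)`!%:R) =
  (\prod_i ((-1) ^+ gamma i * 'C(alpha i, gamma i)%:R)) * poch kd (mdeg gamma)
    * mpoch (fun i => a i + (gamma i)%:R) beta / N`!%:R.
Proof.
move=> a_gt0 le_gN; rewrite mpochD /hahn_coef mpoch_opp_fact.
have fact_neq0 : (mfact gamma)%:R != 0 :> R.
  by rewrite pnatr_eq0 -lt0n mfact_gt0.
have a_neq0 : mpoch a gamma != 0 by rewrite gt_eqF ?mpoch_gt0.
have N_neq0 : N`!%:R != 0 :> R by rewrite pnatr_eq0 -lt0n fact_gt0.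
have M_neq0 : (N - mdeg gamma)`!%:R != 0 :> R.
  by rewrite pnatr_eq0 -lt0n fact_gt0.
have poch_neq0 := @poch_oppN_neq0 R N (mdeg gamma) le_gN.
have sgnE : (-1) ^+ mdeg gamma =
    poch (- N%:R) (mdeg gamma) * (N - mdeg gamma)`!%:R / N`!%:R :> R.
  by rewrite poch_oppN_fact // mulfK.
rewrite sgnE; field.
by rewrite fact_neq0 a_neq0 N_neq0 M_neq0 poch_neq0.
Qed.

(** The value [kd = s + n] with [n = |alpha| - 1] is the one for which [poch_quotient] turns the
    Chu-Vandermonde sum into a polynomial in [gamma]. *)
Lemma hahn_sum_orthogonal_poch {R : realType} {d} (N : nat) (a : 'I_d.+1 -> R)
    (alpha beta : 'X_{1..d.+1}) :
  (forall i, 0 < a i) -> (mdeg beta < mdeg alpha <= N)%N ->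
  \sum_(x : lattice d N)
     hahn_sum N a (\sum_i a i + (mdeg alpha).-1%:R) alpha x *
     (mpoch a (pt x) * mpoch (fun i => a i + (pt x i)%:R) beta
        / (mfact (pt x))%:R) = 0.
Proof.
move=> a_gt0 /andP[lt_ba le_aN].
set n := (mdeg alpha).-1; set b := mdeg beta; set s := \sum_i a i.
have s_gt0 : 0 < s.
  by rewrite /s big_ord_recl ltr_wpDr ?sumr_ge0 // => i _; apply: ltW.
have le_bn : (b <= n)%N by rewrite -ltnS prednK // (leq_trans _ lt_ba).
under eq_bigr => x _ do rewrite mulr_suml.
rewrite exchange_big /=.
(* At [gamma], [p] takes the value [(a + gamma)_beta (s + b + |gamma|)_(n-b)]; its degree is at most
   [b + (n - b) = |alpha| - 1]. *)
pose p : {mpoly R[d.+1]} :=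
  (\prod_i \prod_(j < beta i) ((a i + j%:R)%:MP + 'X_i)) *
  \prod_(j < n - b) ((s + b%:R + j%:R)%:MP + \sum_i 'X_i).
have size_p : (msize p <= mdeg alpha)%N.
  rewrite -(prednK (leq_trans _ lt_ba)) // -/n.
  rewrite -[X in (_ <= X.+1)%N](subnKC le_bn).
  apply: msizeM_leS; last first.
    apply: (msize_prod_affine _ (fun j => (s + b%:R + j%:R)%:MP + \sum_i 'X_i)).
    by move=> j; apply: msize_affine; apply: msize_sumX.
  rewrite /b mdegE; apply: msize_prod_leS => i.
  apply: (msize_prod_affine _ (fun j => (a i + j%:R)%:MP + 'X_i)) => j.
  by rewrite msize_affine // msizeX mdeg1.
have := congr1 ( *%R (poch s (b + N) / poch s n / N`!%:R))
  (alternating_sum_mpoly alpha p size_p).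
rewrite mulr0 mulr_sumr => sum0; rewrite -[RHS]sum0.
apply: eq_bigr => gamma le_g.
have le_gN : (mdeg gamma <= N)%N by apply: leq_trans le_aN; rewrite -ltnS bmdeg.
under eq_bigr => x _ do rewrite -mulrA -mpochD.
rewrite -mulr_sumr.
rewrite (sum_lattice_falling gamma (fun x => mpoch a (x + beta)%MM)
  (subnK le_gN)).
(* Splitting off [(a)_(gamma+beta)] leaves a Chu-Vandermonde sum with parameters
   [a + gamma + beta]. *)
have -> : \sum_(y : lattice d (N - mdeg gamma))
    mpoch a (pt y + gamma + beta)%MM / (mfact (pt y))%:R =
  mpoch a (gamma + beta)%MM * \sum_(y : lattice d (N - mdeg gamma))
    mpoch (fun i => a i + ((gamma + beta)%MM i)%:R) (pt y) / (mfact (pt y))%:R.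
  rewrite mulr_sumr; apply: eq_bigr => y _.
  by rewrite -addmA addmC mpochD mulrA.
rewrite sum_lattice_poch.
have -> : \sum_i (a i + ((gamma + beta)%MM i)%:R) = s + (b + mdeg gamma)%:R.
  rewrite big_split /= -natr_sum; congr (_ + _%:R).
  by rewrite -mdegE mdegD addnC.
have pE : p.@[fun i => (gamma i)%:R] =
    mpoch (fun i => a i + (gamma i)%:R) beta *
    poch (s + (b + mdeg gamma)%:R) (n - b).
  rewrite mevalM !rmorph_prod /=; congr (_ * _); apply: eq_bigr => i _.
    rewrite rmorph_prod; apply: eq_bigr => j _ /=.
    by rewrite mevalD mevalC mevalXU addrAC.
  rewrite mevalD mevalC [X in _ + X]raddf_sum /=.
  under [X in _ + X]eq_bigr => j _ do rewrite mevalXU.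
  by rewrite -natr_sum -mdegE natrD [LHS]addrAC addrA.
rewrite pE (mulrA (mpoch a _)) (mulrAC (mpoch a _)).
rewrite (mulrA (hahn_coef _ _ _ _ _)) hahn_coef_falling //.
have := poch_quotient s n N b (mdeg gamma) s_gt0 le_bn le_gN.
move: (poch _ (N - _)) (poch (s + n%:R) _) (poch _ (n - b)) => P1 P2 P3 eqP.
ring: eqP.
Qed.

(** Passes from [(a + x)_beta] to monomials by induction on [|m|], through [x_i (a + x)_beta = (a +
    x)_(beta + U_(i)) - (a_i + beta_i) (a + x)_beta]. Neither term raises [|beta| + |m|], but [beta]
    changes. *)
Lemma hahn_sum_orthogonal_monomial {R : realType} {d} (N : nat)
    (a : 'I_d.+1 -> R) (alpha beta : 'X_{1..d.+1}) (m : 'X_{1..d.+1}) :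
  (forall i, 0 < a i) -> (mdeg beta + mdeg m < mdeg alpha <= N)%N ->
  \sum_(x : lattice d N)
     hahn_sum N a (\sum_i a i + (mdeg alpha).-1%:R) alpha x *
     (mpoch a (pt x) * mpoch (fun i => a i + (pt x i)%:R) beta
        / (mfact (pt x))%:R) * \prod_i (pt x i)%:R ^+ m i = 0.
Proof.
move=> a_gt0; have [k] := ubnP (mdeg m).
elim: k m beta => // k IHk m beta; rewrite ltnS => le_mk /andP[lt_ba le_aN].
have [->|m_neq0] := eqVneq m 0%MM.
  rewrite -[RHS](hahn_sum_orthogonal_poch N a alpha beta a_gt0); last first.
    by rewrite le_aN (leq_ltn_trans _ lt_ba) ?leq_addr.
  apply: eq_bigr => x _; rewrite [X in _ * X]big1 ?mulr1 // => i _.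
  by rewrite mnm0E.
have [i m_i] : exists i, (0 < m i)%N.
  apply/existsP; apply: contra_neqT m_neq0; rewrite negb_exists => /forallP m0.
  by apply/mnmP => i; rewrite mnm0E; apply/eqP; rewrite -leqn0 leqNgt m0.
pose m' := (m - U_(i))%MM.
have def_m : m = (m' + U_(i))%MM.
  rewrite submK //; apply/mnm_lepP => j; rewrite mnm1E.
  by case: eqP => // <-.
have deg_m : mdeg m = (mdeg m').+1 by rewrite def_m mdegD mdeg1 addn1.
have IH1 := IHk m' (beta + U_(i))%MM; have IH2 := IHk m' beta.
rewrite deg_m in le_mk lt_ba.
(* The right side is written as [0 - (a_i + beta_i) 0], and each zero is replaced by a sum that
   vanishes by induction. *)
rewrite -[RHS](subr0 0) -[X in _ = X - _]IH1 //; last first.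
  by rewrite mdegD mdeg1 addn1 addSnnS lt_ba.
rewrite -[X in _ = _ - X](mulr0 (a i + (beta i)%:R)).
rewrite -[X in _ = _ - _ * X]IH2 //; last first.
  by rewrite le_aN andbT (leq_trans _ lt_ba) // addnS ltnW.
rewrite mulr_sumr -sumrB; apply: eq_bigr => x _.
have -> : \prod_j (pt x j)%:R ^+ m j =
    (pt x i)%:R * \prod_j (pt x j)%:R ^+ m' j :> R.
  rewrite (bigD1 i) //= [in RHS](bigD1 i) //= def_m mnmDE mnm1E eqxx addn1.
  rewrite exprS -mulrA; congr (_ * (_ * _)); apply: eq_bigr => j ne_ji.
  by rewrite mnmDE mnm1E eq_sym (negbTE ne_ji) addn0.
rewrite mpochD mpoch1; ring.
Qed.

Lemma hahn_sum_orthogonal {R : realType} {d} (N : nat) (kappa : 'I_d.+1 -> R)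
    (alpha : 'X_{1..d.+1}) (p : {mpoly R[d]}) :
  let a i := kappa i + 1 in
  (forall i, 0 < a i) -> (mdeg alpha <= N)%N -> (msize p <= mdeg alpha)%N ->
  hahn_inner kappa
    [ffun x => hahn_sum N a (\sum_i a i + (mdeg alpha).-1%:R) alpha x]
    (polyfun N p) = 0.
Proof.
move=> a a_gt0 le_aN le_p; rewrite /hahn_inner.
apply/eqP; rewrite mulf_eq0; apply/orP; right; apply/eqP.
under eq_bigr => x _ do rewrite !ffunE mevalE mulr_sumr mulr_suml.
rewrite exchange_big big_seq big1 //= => m m_p.
(* A monomial in the first [d] coordinates is one in all [d + 1], with last exponent 0. *)
pose m1 := mnmwiden m.
have deg_m1 : mdeg m1 = mdeg m.
  rewrite !mdegE big_ord_recr /= mnmwiden_ordmax addn0.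
  by apply: eq_bigr => i _; rewrite mnmwiden_widen.
have := hahn_sum_orthogonal_monomial N a alpha 0%MM m1 a_gt0.
rewrite mdeg0 add0n deg_m1 le_aN (leq_trans (msize_mdeg_lt m_p)) // => /(_ isT).
move/(congr1 ( *%R p@_m)); rewrite mulr0 mulr_sumr => sum0; rewrite -[RHS]sum0.
apply: eq_bigr => x _.
have -> : \prod_i (pt x i)%:R ^+ m1 i =
    \prod_i (pt x (widen_ord (leqnSn d) i))%:R ^+ m i :> R.
  rewrite big_ord_recr /= mnmwiden_ordmax expr0 mulr1.
  by apply: eq_bigr => i _; rewrite mnmwiden_widen.
have -> : mpoch (fun i => a i + (pt x i)%:R) 0%MM = 1.
  by rewrite /mpoch big1 // => i _; rewrite mnm0E poch0.
rewrite /a; ring.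
Qed.

(** * Definiteness of the inner product and polynomial representatives *)

Lemma deg_ltP {R : realType} {d N n} (p : {mpoly R[d]})
    (f : {ffun lattice d N -> R}) :
  (msize p <= n)%N -> (forall x, f x = polyfun N p x) -> deg_lt R d N n f.
Proof. by move=> le_p eq_f; exists p => //; apply/ffunP. Qed.

Lemma deg_ltB {R : realType} {d N n} (f g : {ffun lattice d N -> R}) :
  deg_lt R d N n f -> deg_lt R d N n g -> deg_lt R d N n (f - g).
Proof.
move=> [p le_p ->] [q le_q ->]; apply: (deg_ltP (p - q)) => [|x].
  by apply: leq_trans (msizeD_le _ _) _; rewrite msizeN geq_max le_p.
by rewrite !ffunE raddfB.
Qed.

(** The normalizing factor and all weights are positive, so every square in the sum vanishes. *)
Lemma hahn_inner_eq0 {R : realType} {d N} (kappa : 'I_d.+1 -> R)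
    (f : {ffun lattice d N -> R}) :
  (forall i, -1 < kappa i) -> hahn_inner kappa f f = 0 -> f = 0.
Proof.
move=> kappa_gt.
have a_gt0 i : 0 < kappa i + 1 by rewrite -ltrBlDr sub0r.
have w_gt0 (x : lattice d N) :
    0 < mpoch (fun i => kappa i + 1) (pt x) / (mfact (pt x))%:R.
  by rewrite divr_gt0 ?mpoch_gt0 // ltr0n mfact_gt0.
have s_gt0 : 0 < \sum_i kappa i + d%:R + 1.
  have -> : \sum_i kappa i + d%:R + 1 = \sum_(i < d.+1) (kappa i + 1).
    by rewrite big_split /= sumr_const card_ord -addrA natr1.
  by rewrite big_ord_recl ltr_wpDr ?sumr_ge0 // => i _; apply: ltW.
move/eqP; rewrite mulf_eq0 gt_eqF /=; last first.
  by rewrite divr_gt0 ?poch_gt0 // ltr0n fact_gt0.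
have term_ge0 (x : lattice d N) : true -> 0 <= f x * f x *
    (mpoch (fun i => kappa i + 1) (pt x) / (mfact (pt x))%:R).
  by move=> _; rewrite mulr_ge0 ?(ltW (w_gt0 x)) // -expr2 sqr_ge0.
move/eqP/(psumr_eq0P term_ge0) => f0; apply/ffunP => x; rewrite ffunE.
move/eqP: (f0 x isT).
by rewrite mulf_eq0 (gt_eqF (w_gt0 x)) orbF mulf_eq0 orbb => /eqP.
Qed.

Lemma lepm_mdeg_anti {k} (m1 m2 : 'X_{1..k}) :
  (m1 <= m2)%MM -> (mdeg m2 <= mdeg m1)%N -> m1 = m2.
Proof.
move=> le_m; rewrite -{1}(submK le_m) mdegD -[X in (_ <= X)%N]add0n leq_add2r.
by rewrite leqn0 mdeg_eq0 => /eqP m0; rewrite -(submK le_m) m0 add0m.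
Qed.

(* On the simplex [x_{d+1} = N - x_1 - ... - x_d]. *)
Definition coordinate_poly (R : realType) (d N : nat) (i : 'I_d.+1) :
    {mpoly R[d]} :=
  if unlift ord_max i is Some j then 'X_j else N%:R%:MP - \sum_j 'X_j.

Definition falling_poly (R : realType) (d N : nat) (gamma : 'X_{1..d.+1}) :
    {mpoly R[d]} :=
  \prod_i \prod_(j < gamma i) ((- j%:R)%:MP + coordinate_poly R d N i).

(** Eliminating the last coordinate replaces it by an affine form, which keeps every factor of
    degree at most 1. *)
Lemma msize_falling_poly {R : realType} {d N} (gamma : 'X_{1..d.+1}) :
  (msize (falling_poly R d N gamma) <= (mdeg gamma).+1)%N.
Proof.
rewrite mdegE; apply: msize_prod_leS => i.
apply: (msize_prod_affine _ (fun j => (- j%:R)%:MP + _)) => j.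
apply: msize_affine; rewrite /coordinate_poly; case: unliftP => [l _|_].
  by rewrite msizeX mdeg1.
by apply: msize_affine; rewrite msizeN msize_sumX.
Qed.

Lemma polyfun_coordinate {R : realType} {d N} (i : 'I_d.+1) (x : lattice d N) :
  polyfun N (coordinate_poly R d N i) x = (pt x i)%:R.
Proof.
have widenE (j : 'I_d) : widen_ord (leqnSn d) j = lift ord_max j.
  by apply/ord_inj; rewrite lift_max.
rewrite ffunE /coordinate_poly; case: unliftP => [j ->|->].
  by rewrite mevalXU widenE.
rewrite mevalB mevalC [X in _ - X]raddf_sum /=.
under [X in _ - X]eq_bigr => j _ do rewrite mevalXU.
apply/eqP; rewrite subr_eq -natr_sum -natrD -[X in X%:R == _](mdeg_pt x) mdegE.
by rewrite big_ord_recr /= addnC.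
Qed.

Lemma polyfun_falling {R : realType} {d N} (gamma : 'X_{1..d.+1})
    (x : lattice d N) :
  polyfun N (falling_poly R d N gamma) x = hahn_m R d N gamma x.
Proof.
rewrite hahn_mE ffunE /falling_poly rmorph_prod; apply: eq_bigr => i _ /=.
rewrite rmorph_prod /=.
under eq_bigr => j _.
  rewrite mevalD mevalC.
  have := @polyfun_coordinate R d N i x; rewrite ffunE => ->; over.
elim: (gamma i) => [|g IHg]; first by rewrite big_ord0 ffactn0.
rewrite big_ord_recr /= IHg ffactnSr natrM.
have [le_g|lt_g] := leqP g (pt x i); first by rewrite natrB // addrC.
by rewrite ffact_small // !mul0r.
Qed.

(** * Uniqueness and the monic normalization *)

(** [P - Q] has degree below [|alpha|] and is orthogonal to all such functions, hence to itself. *)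
Lemma monic_hahn_unique {R : realType} {d N} (kappa : 'I_d.+1 -> R)
    (alpha : 'X_{1..d.+1}) (P Q : {ffun lattice d N -> R}) :
  (forall i, -1 < kappa i) ->
  is_monic_hahn kappa alpha P -> is_monic_hahn kappa alpha Q -> P = Q.
Proof.
move=> kappa_gt [[_ orthP] monP] [[_ orthQ] monQ].
apply/eqP; rewrite -subr_eq0; apply/eqP/(hahn_inner_eq0 kappa) => //.
have low : deg_lt R d N (mdeg alpha) (P - Q).
  by have := deg_ltB _ _ monP monQ; rewrite opprB addrA subrK.
rewrite -[RHS](subr0 0) -[X in _ = X - _](orthP _ low).
rewrite -[X in _ = _ - X](orthQ _ low) /hahn_inner -mulrBr -sumrB.
by congr (_ * _); apply: eq_bigr => x _; rewrite !ffunE !mulrBl.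
Qed.

Lemma hahn_innerZl {R : realType} {d N} (kappa : 'I_d.+1 -> R) (c : R)
    (f g : {ffun lattice d N -> R}) :
  hahn_inner kappa [ffun x => c * f x] g = c * hahn_inner kappa f g.
Proof.
rewrite /hahn_inner mulrCA; congr (_ * _); rewrite mulr_sumr.
by apply: eq_bigr => x _; rewrite ffunE !mulrA.
Qed.

(** Serves both for the whole expansion of [Q_alpha] and for the expansion without its leading term,
    hence the general [P]. *)
Lemma deg_lt_sum_falling {R : realType} {d N n k} (P : pred 'X_{1..d.+1 < k})
    (c : R) (C : 'X_{1..d.+1 < k} -> R) (f : {ffun lattice d N -> R}) :
  (forall gamma : 'X_{1..d.+1 < k}, P gamma -> (mdeg gamma < n)%N) ->
  (forall x, f x = c * \sum_(gamma | P gamma) C gamma * hahn_m R d N gamma x) ->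
  deg_lt R d N n f.
Proof.
move=> lt_n eq_f; apply: (deg_ltP
  (c *: \sum_(gamma | P gamma) C gamma *: falling_poly R d N gamma)) => [|x].
  apply: leq_trans (msizeZ_le _ _) _; apply: leq_trans (msize_sum _ _ _) _.
  apply/bigmax_leqP => gamma P_gamma; apply: leq_trans (msizeZ_le _ _) _.
  exact: leq_trans (msize_falling_poly gamma) (lt_n _ P_gamma).
rewrite eq_f ffunE mevalZ raddf_sum /=; congr (_ * _); apply: eq_bigr => gamma _.
by rewrite mevalZ -polyfun_falling ffunE.
Qed.

Theorem theorem3p6 (R : realType) (d N : nat) (kappa : 'I_d.+1 -> R)
    (alpha : 'X_{1..d.+1}) (x : lattice d N) :
  (0 < d)%N ->
  (forall i, -1 < kappa i) ->
  (mdeg alpha <= N)%N ->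
  let kd : R := \sum_i kappa i + d%:R + (mdeg alpha)%:R in
  let kappa1 : 'I_d.+1 -> R := fun i => kappa i + 1 in
  monic_hahn N kappa alpha x =
    poch (- N%:R) (mdeg alpha) * mpoch kappa1 alpha / poch kd (mdeg alpha) *
    \sum_(gamma : 'X_{1..d.+1 < (mdeg alpha).+1} | (gamma <= alpha)%MM)
      (mpoch (fun i => - (alpha i)%:R) gamma * poch kd (mdeg gamma)
         * (-1) ^+ mdeg gamma)
      / ((mfact gamma)%:R * mpoch kappa1 gamma * poch (- N%:R) (mdeg gamma))
      * hahn_m R d N gamma x.
Proof.
move=> _ kappa_gt le_aN kd kappa1.
set c := poch (- N%:R) (mdeg alpha) * mpoch kappa1 alpha / _.
rewrite -/(hahn_sum N kappa1 kd alpha x).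
have a_gt0 i : 0 < kappa1 i by rewrite -ltrBlDr sub0r.
pose F : {ffun lattice d N -> R} := [ffun y => hahn_sum N kappa1 kd alpha y].
pose Q : {ffun lattice d N -> R} := [ffun y => c * F y].
suff Q_monic : is_monic_hahn kappa alpha Q.
  rewrite /monic_hahn (xget_unique _ Q_monic) ?ffunE ?ffunE // => P P_monic.
  exact: (monic_hahn_unique kappa alpha).
(* For [alpha = 0] the truncated predecessor would break this identity. *)
have kdE : (0 < mdeg alpha)%N -> kd = \sum_i kappa1 i + (mdeg alpha).-1%:R.
  move=> alpha_gt0; rewrite big_split /= sumr_const card_ord /kd.
  by rewrite -{1}(prednK alpha_gt0) -!natr1; ring.
have kd_neq0 : poch kd (mdeg alpha) != 0.
  (* For [alpha = 0], [kd] may be zero or negative, but the Pochhammer symbol is then an empty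
     product. *)
  case: (posnP (mdeg alpha)) => [->|alpha_gt0]; first by rewrite poch0 oner_neq0.
  rewrite gt_eqF // poch_gt0 // kdE // ltr_wpDr //.
  by rewrite big_ord_recl ltr_wpDr ?sumr_ge0 // => i _; apply: ltW.
(* The prefactor [c] is what makes the coefficient of [m_alpha] equal to 1. *)
have coef_alpha : c * hahn_coef N kappa1 kd alpha alpha = 1.
  have sgnE : \prod_i ((-1) ^+ alpha i * 'C(alpha i, alpha i)%:R) =
      (-1) ^+ mdeg alpha :> R.
    by rewrite -prodr_exp_mdeg; apply: eq_bigr => i _; rewrite binn mulr1.
  have sgn2 : (-1) ^+ mdeg alpha * (-1) ^+ mdeg alpha = 1 :> R.
    by rewrite -exprMn mulrNN mulr1 expr1n.
  rewrite /c /hahn_coef mpoch_opp_fact sgnE.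
  have N_neq0 := @poch_oppN_neq0 R N (mdeg alpha) le_aN.
  have fact_neq0 : (mfact alpha)%:R != 0 :> R.
    by rewrite pnatr_eq0 -lt0n mfact_gt0.
  have a_neq0 : mpoch kappa1 alpha != 0 by rewrite gt_eqF ?mpoch_gt0.
  field: sgn2.
  by rewrite N_neq0 fact_neq0 a_neq0 kd_neq0.
have lt_deg (gamma : 'X_{1..d.+1 < (mdeg alpha).+1}) :
    (gamma <= alpha)%MM -> (mdeg gamma < (mdeg alpha).+1)%N.
  by rewrite bmdeg.
split; first split.
- apply: (deg_lt_sum_falling _ c (fun gamma => hahn_coef N kappa1 kd alpha gamma)
    _ lt_deg) => y.
  by rewrite !ffunE.
- move=> _ [p le_p ->]; rewrite hahn_innerZl.
  (* For [alpha = 0] the only test function is zero. *)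
  case: (posnP (mdeg alpha)) => [alpha0|alpha_gt0]; last first.
    by rewrite /F kdE // hahn_sum_orthogonal ?mulr0.
  have /eqP -> : p == 0 by rewrite -msize_poly_eq0 -leqn0 -alpha0.
  rewrite /hahn_inner [X in _ * (_ * X)]big1 ?mulr0 // => y _.
  by rewrite [polyfun _ _ _]ffunE raddf0 mulr0 mul0r.
(* [alpha] as an index of the sum: removing its term leaves [Q - m_alpha], and every other
   [gamma <= alpha] has smaller degree. *)
pose alpha' := BMultinom (ltnSn (mdeg alpha)).
apply: (deg_lt_sum_falling
  (fun gamma => (gamma <= alpha)%MM && (gamma != alpha')) c
  (fun gamma => hahn_coef N kappa1 kd alpha gamma)) => [gamma|y].
  case/andP=> le_g; rewrite bmeqP /= => ne_g; rewrite ltnNge.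
  by apply: contra ne_g => le_deg; apply/eqP/lepm_mdeg_anti.
rewrite !ffunE /hahn_sum (bigD1 alpha') ?lepm_refl //= mulrDr mulrA coef_alpha.
by rewrite mul1r [hahn_m _ _ _ _ y]ffunE addrAC subrr add0r.
Qed.
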